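(* Let $X$ be a Banach space, let $\mathcal{U}$ be a nontrivial ultrafilter on $\mathbb{N}$, and let $X^{\mathcal{U}}$ be the corresponding ultraproduct (ultrapower) of $X$. Let $N\subset X^{\mathcal{U}}$ be a subset which, with the metric induced from the norm of $X^{\mathcal{U}}$, is a locally finite metric space. Then $N$ admits a bilipschitz embedding into $X$.
   Context: A metric space $(A,d_A)$ is called discrete if there exists a constant $\delta>0$ such that $d_A(u,v)\ge\delta$ for all $u,v\in A$ with $u\neq v$. A discrete metric space $A$ is called locally finite if for every $u\in A$ and every $r>0$ the set $\{a\in A: d_A(u,a)\le r\}$ is finite. A map $f:(A,d_A)\to(Y,d_Y)$ between metric spaces is called a bilipschitz embedding if there exist $C<\infty$ and $r>0$ such that $$\forall u,v\in A\quad r\,d_A(u,v)\le d_Y(f(u),f(v))\le r\,C\,d_A(u,v).$$ Nontrivial ultrafilter means non-principal ultrafilter. The Banach space $X^{\mathcal{U}}$ is the quotient of the space $\ell_\infty(\mathbb{N},X)$ of bounded sequences in $X$ by the closed subspace of sequences $(x_i)$ with $\lim_{\mathcal{U}}\|x_i\|=0$, with norm $\|(x_i)\|_{X^{\mathcal{U}}}=\lim_{\mathcal{U}}\|x_i\|$. Banach spaces are regarded as metric spaces with the metric $\|x-y\|$. *)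

(* Defs.v *)
From HB Require Import structures.
From mathcomp Require Import all_boot all_order all_algebra generic_quotient.
From mathcomp Require Import ring_quotient.
From mathcomp Require Import all_classical all_reals all_analysis.

Set Implicit Arguments.
Unset Strict Implicit.
Unset Printing Implicit Defensive.
Import Order.TTheory GRing.Theory Num.Theory.
Import numFieldNormedType.Exports.
Local Open Scope classical_set_scope.
Local Open Scope ring_scope.
Local Open Scope quotient_scope.

Section metric_notions.
Context {R : realType}.

Definition discrete_metric (A : metricType R) : Prop :=
  exists2 delta : R, 0 < delta &
    forall u v : A, u <> v -> delta <= mdist u v.

Definition locally_finite (A : metricType R) : Prop :=
  discrete_metric A /\
  forall (u : A) (r : R), 0 < r -> finite_set [set a : A | mdist u a <= r].

Definition bilipschitz_embedding (A Y : metricType R) (f : A -> Y) : Prop :=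
  exists C r : R, 0 < r /\
    forall u v : A, r * mdist u v <= mdist (f u) (f v) /\
                    mdist (f u) (f v) <= r * C * mdist u v.

End metric_notions.

(* The pseudometric structure of [set_type N] is the library's, pulled back
   along the inclusion; it is a metric when the ambient space is one. *)
Section induced_metric.
Context {R : realType} {T : metricType R} (N : set T).

Let dist (u v : N) : R := mdist (set_val u) (set_val v).

Let dist_ge0 u v : 0 <= dist u v. Proof. exact: mdist_ge0. Qed.

Let dist_positivity u v : dist u v = 0 -> u = v.
Proof. by move=> /mdist_positivity; rewrite set_valE => /val_inj. Qed.

Let ballEdist u d : ball u d = [set v | dist u v < d].
Proof. by rewrite -initial_ballE ballEmdist. Qed.

HB.instance Definition _ := @PseudoMetric_isMetric.Build R (set_type N)
  dist dist_ge0 dist_positivity ballEdist.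

End induced_metric.

(* Normed modules are not instances of [metricType]; this alias carries the
   metric [`|x - y|]. *)
Definition normed_metric (R : realType) (V : normedModType R) : Type := V.

Section normed_metric.
Context {R : realType} {V : normedModType R}.

Let dist (x y : V) : R := `|x - y|.

Let dist_ge0 x y : 0 <= dist x y. Proof. exact: normr_ge0. Qed.

Let dist_positivity x y : dist x y = 0 -> x = y.
Proof. by move/normr0_eq0/eqP; rewrite subr_eq0 => /eqP. Qed.

Let ballEdist x d : ball x d = [set y | dist x y < d].
Proof. by rewrite -ball_normE. Qed.

HB.instance Definition _ := PseudoMetric.on (normed_metric V).
HB.instance Definition _ := @PseudoMetric_isMetric.Build R (normed_metric V)
  dist dist_ge0 dist_positivity ballEdist.

Lemma normed_mdistE (x y : V) :
  mdist (x : normed_metric V) (y : normed_metric V) = `|x - y|.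
Proof. by []. Qed.

End normed_metric.

Definition nonprincipal (U : set_system nat) : Prop :=
  forall n : nat, U <> principal_filter n.

Section ultralimit.
Context {R : realType} (U : set_system nat) {UU : UltraFilter U}.

Lemma bounded_ultralim (u : nat -> R) (M : R) :
  (forall n, `|u n| <= M) -> u @ U --> lim (u @ U).
Proof.
move=> uM; have uU : UltraFilter (u @ U).
  split=> [|G GP sUG]; first exact: fmap_proper_filter.
  apply/seteqP; split=> [A GA|//].
  have [//|UnA] := in_ultra_setVsetC (u @^-1` A) UU.
  have /(filterI GA) : G (~` A) by exact: sUG.
  by rewrite setICr => /filter_not_empty.
have : compact `[- M, M] by exact: segment_compact.
rewrite compact_ultra => /(_ _ uU) [].
  apply: (@filterS _ U _ setT); last exact: filterT.
  by move=> n _; rewrite /= in_itv /= -ler_norml.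
by move=> l [_ ul]; apply/cvg_ex; exists l.
Qed.

End ultralimit.

Section linfty.
Context {R : realType} (X : normedModType R).

Definition bounded_seq : {pred nat -> X} := fun x => `[< bounded_fun x >].

Lemma bounded_seqP (x : nat -> X) :
  reflect (exists M : R, forall n, `|x n| <= M) (x \in bounded_seq).
Proof.
apply: (iffP (asboolP _)) => [[M [Mr xM]]|[M xM]].
  by exists (M + 1) => n; apply: xM => //; rewrite ltrDl.
by exists M; split; [exact: num_real|move=> N MN n _; exact/(le_trans (xM n))/ltW].
Qed.

Lemma bounded_seq_submod_closed : submod_closed bounded_seq.
Proof.
split=> [|a x y /bounded_seqP[M xM] /bounded_seqP[N yN]]; apply/bounded_seqP.
  by exists 0 => n; rewrite normr0.
exists (`|a| * M + N) => n; rewrite (le_trans (ler_normD _ _))// lerD//.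
by rewrite normrZ ler_wpM2l.
Qed.

HB.instance Definition _ :=
  GRing.isSubmodClosed.Build R (nat -> X) bounded_seq bounded_seq_submod_closed.

Record linfty := Linfty {
  linfty_seq :> nat -> X ; linfty_seqP : linfty_seq \in bounded_seq }.

HB.instance Definition _ := [isSub for linfty_seq].
HB.instance Definition _ := [Choice of linfty by <:].
HB.instance Definition _ := [SubChoice_isSubLmodule of linfty by <:].

End linfty.

Section ultrapower.
Context {R : realType} (X : normedModType R) (U : set_system nat).
Variable UU : UltraFilter U.

(* [ultranorm x] is the limit of [`|x n|] along [U]; the limit exists because
   [x] is bounded, see [ultranorm_cvg]. *)
Definition ultranorm (x : linfty X) : R := lim (`|x n| @[n --> U]).

Lemma ultranorm_cvg (x : linfty X) : `|x n| @[n --> U] --> ultranorm x.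
Proof.
have /bounded_seqP[M xM] := linfty_seqP x.
by apply: (@bounded_ultralim _ _ UU _ M) => n; rewrite normr_id.
Qed.

Lemma ultranorm_ge0 x : 0 <= ultranorm x.
Proof.
by apply: limr_ge; [apply/cvg_ex; eexists; exact: ultranorm_cvg|exact: nearW].
Qed.

Lemma ultranormD x y : ultranorm (x + y) <= ultranorm x + ultranorm y.
Proof.
apply: (ler_cvg_to (@ultranorm_cvg (x + y))
  (cvgD (@ultranorm_cvg x) (@ultranorm_cvg y))).
by apply: nearW => n; exact: ler_normD.
Qed.

Lemma ultranormZ a x : ultranorm (a *: x) = `|a| * ultranorm x.
Proof.
apply/cvg_lim => //; under eq_fun do rewrite /= normrZ.
exact: cvgMr (@ultranorm_cvg x).
Qed.

Lemma ultranormN x : ultranorm (- x) = ultranorm x.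
Proof. by rewrite -scaleN1r ultranormZ normrN1 mul1r. Qed.

(* The proof that [U] is an ultrafilter is an explicit argument of [null_seq]
   and [ultrapower], so that their algebraic structures can be inferred. *)
Definition null_seq of UltraFilter U : {pred linfty X} :=
  fun x => ultranorm x == 0.

Lemma null_seq_submod_closed : submod_closed (null_seq UU).
Proof.
split=> [|a x y /eqP x0 /eqP y0]; apply/eqP.
  by rewrite -(scale0r 0) ultranormZ normr0 mul0r.
apply/eqP; rewrite eq_le ultranorm_ge0 andbT.
by rewrite (le_trans (ultranormD _ _))// ultranormZ x0 y0 mulr0 addr0.
Qed.

HB.instance Definition _ :=
  GRing.isSubmodClosed.Build R (linfty X) (null_seq UU) null_seq_submod_closed.

(* [Quotient.quot] only provides the additive group; scaling and the norm are
   added below and characterized by [ultraclassZ] and [norm_ultraclass]. *)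
Definition ultrapower : Type := Quotient.quot (null_seq UU).

HB.instance Definition _ := GRing.Zmodule.on ultrapower.
HB.instance Definition _ := EqQuotient.on ultrapower.

Definition ultraclass (x : linfty X) : ultrapower := \pi_ultrapower x.

Lemma ultraclassD x y : ultraclass (x + y) = ultraclass x + ultraclass y.
Proof. exact: (@pi_addr _ _ _ _ _ (Quotient.quot (null_seq UU))). Qed.

Lemma ultraclassN x : ultraclass (- x) = - ultraclass x.
Proof. exact: (@pi_oppr _ _ _ _ _ (Quotient.quot (null_seq UU))). Qed.

Lemma ultraclass0 : ultraclass 0 = 0.
Proof. exact: (@pi_zeror _ _ _ _ _ (Quotient.quot (null_seq UU))). Qed.

Lemma ultraclassP x y : ultraclass x = ultraclass y <-> ultranorm (x - y) = 0.
Proof.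
split=> [/eqP|/eqP xy]; last apply/eqP; last rewrite /ultraclass.
  by rewrite -Quotient.idealrBE => /eqP.
by rewrite -Quotient.idealrBE.
Qed.

Lemma ultraclass_repr (q : ultrapower) : ultraclass (repr q) = q.
Proof. exact: reprK. Qed.

Definition ultrapower_scale (a : R) (q : ultrapower) : ultrapower :=
  ultraclass (a *: repr q).

Lemma ultraclassZ a x : ultraclass (a *: x) = ultrapower_scale a (ultraclass x).
Proof.
apply/ultraclassP; rewrite -scalerBr ultranormZ.
have -> : ultranorm (x - repr (ultraclass x)) = 0.
  by apply/ultraclassP; rewrite ultraclass_repr.
by rewrite mulr0.
Qed.

Fact ultrapower_scalerA a b q :
  ultrapower_scale a (ultrapower_scale b q) = ultrapower_scale (a * b) q.
Proof. by rewrite -(ultraclass_repr q) -!ultraclassZ scalerA. Qed.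

Fact ultrapower_scale1r : left_id 1 ultrapower_scale.
Proof. by move=> q; rewrite -(ultraclass_repr q) -ultraclassZ scale1r. Qed.

Fact ultrapower_scalerDr : right_distributive ultrapower_scale +%R.
Proof.
move=> a p q; rewrite -(ultraclass_repr p) -(ultraclass_repr q).
by rewrite -ultraclassD -!ultraclassZ scalerDr ultraclassD.
Qed.

Fact ultrapower_scalerDl q : {morph ultrapower_scale^~ q : a b / a + b}.
Proof.
by move=> a b; rewrite -(ultraclass_repr q) -!ultraclassZ scalerDl ultraclassD.
Qed.

HB.instance Definition _ := GRing.Zmodule_isLmodule.Build R ultrapower
  ultrapower_scalerA ultrapower_scale1r ultrapower_scalerDr ultrapower_scalerDl.

Definition ultrapower_norm (q : ultrapower) : R := ultranorm (repr q).

Lemma ultrapower_norm_class x : ultrapower_norm (ultraclass x) = ultranorm x.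
Proof.
have le_ultra y z : ultraclass y = ultraclass z -> ultranorm y <= ultranorm z.
  move=> /ultraclassP yz; rewrite -(subrK z y).
  by rewrite (le_trans (ultranormD _ _))// yz add0r.
by apply: le_anti; rewrite !le_ultra// ultraclass_repr.
Qed.

Fact ultrapower_normD p q :
  ultrapower_norm (p + q) <= ultrapower_norm p + ultrapower_norm q.
Proof.
rewrite -(ultraclass_repr p) -(ultraclass_repr q) -ultraclassD.
by rewrite !ultrapower_norm_class ultranormD.
Qed.

Fact ultrapower_normZ a q :
  ultrapower_norm (a *: q) = `|a| * ultrapower_norm q.
Proof.
rewrite -(ultraclass_repr q) -[_ *: _]ultraclassZ.
by rewrite !ultrapower_norm_class ultranormZ.
Qed.

Fact ultrapower_norm0_eq0 q : ultrapower_norm q = 0 -> q = 0.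
Proof.
rewrite -(ultraclass_repr q) ultrapower_norm_class => q0.
by rewrite -ultraclass0; apply/ultraclassP; rewrite subr0.
Qed.

HB.instance Definition _ := Lmodule_isNormed.Build R ultrapower
  ultrapower_normD ultrapower_normZ ultrapower_norm0_eq0.

Lemma norm_ultraclass (x : linfty X) : `|ultraclass x| = ultranorm x.
Proof. exact: ultrapower_norm_class. Qed.

End ultrapower.

(* Main.v *)
Require Import Defs.
From mathcomp Require Import all_boot all_order all_algebra.
From mathcomp Require Import all_classical all_reals all_analysis.
From mathcomp Require Import lra.

(** Represent [a] in the ultrapower by a bounded sequence [a_n].  A point of norm
    at scale [i] is sent to the interpolation [(1 - w) a_(k i) + w a_(k i.+1)],
    where [w] depends on the norm of [a].  For bounded sequences [x], [y] the
    iterated limit of [|x_k + y_n|] (first [n], then [k], along [U]) is at least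
    a third of the limit of [|x_n + y_n|]; hence the indices [k i] can be chosen
    one after the other so that the finitely many pairs of points living at scale
    [i] are bilipschitzly embedded.  Pairs at distant scales have norms so
    different that the triangle inequality suffices. *)

Set Implicit Arguments.
Unset Strict Implicit.
Unset Printing Implicit Defensive.
Import Order.TTheory GRing.Theory Num.Theory.
Import numFieldNormedType.Exports.
Local Open Scope classical_set_scope.
Local Open Scope ring_scope.

(** * Finite intersections in a filter and dependent choice *)

Lemma filter_finite_forall (T : choiceType) (I : Type) (F : set_system I)
    (A : set T) (P : T -> set I) : Filter F -> finite_set A ->
  (forall a, A a -> F (P a)) -> F [set i | forall a, A a -> P a i].
Proof.
move=> FF /finite_fsetP[D ->] FP.
exact: (filter_bigI (D := D)).
Qed.

(** Dependent choice: [S i k] is the invariant that [k], chosen at stage [i], still has a valid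
    successor. *)
Lemma chain_choice (Q : nat -> nat -> nat -> Prop) (S : nat -> set nat) :
  (exists k, S 0%N k) ->
  (forall i k, S i k -> exists2 n, S i.+1 n & Q i k n) ->
  exists k : nat -> nat, forall i, Q i (k i) (k i.+1).
Proof.
move=> [k0 Sk0] SQ.
have /choice[g gP] : forall ik : nat * nat, exists n,
    S ik.1 ik.2 -> S ik.1.+1 n /\ Q ik.1 ik.2 n.
  move=> [i k]; have [/SQ[n Sn Qn]|nS] := pselect (S i k); first by exists n.
  by exists 0%N.
pose k := fix k i := if i is j.+1 then g (j, k j) else k0.
exists k => i; have Sk : S i (k i) by elim: i => //= i /(gP (i, k i))[].
by have [] := gP (i, k i) Sk.
Qed.

(** * Iterated limits along the ultrafilter *)

Section ultrapower_iterated.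
Context {R : realType} (X : normedModType R) (U : set_system nat).
Variable UU : UltraFilter U.

Lemma near_ultranorm_le (x : linfty X) (e : R) : 0 < e ->
  \forall n \near U, `|x n| <= `|ultraclass UU x| + e.
Proof.
move=> e0; have /cvgrPdist_le/(_ _ e0) := @ultranorm_cvg _ _ _ UU x.
rewrite norm_ultraclass; apply: filterS => n /=.
by rewrite ler_norml => /andP[+ _]; lra.
Qed.

Lemma ultranorm_le (x : linfty X) (e : R) :
  (\forall n \near U, `|x n| <= e) -> `|ultraclass UU x| <= e.
Proof.
rewrite norm_ultraclass => xe; apply: limr_le => //.
by apply/cvg_ex; eexists; exact: (@ultranorm_cvg _ _ _ UU).
Qed.

(* For generic [k], then generic [n], then generic [j]:
   [x n + y n = (x n + y j) - (x k + y j) + (x k + y n)]. *)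
Lemma near_iterated_ge (x y : linfty X) (e : R) : 0 < e ->
  \forall k \near U, \forall n \near U,
    `|ultraclass UU (x + y)| / 3 - e <= `|x k + y n|.
Proof.
move=> e0; set E := _ / 3 - e.
have [//|K] := in_ultra_setVsetC
  [set k | \forall n \near U, E <= `|x k + y n|] UU.
have lt_near k : (~ \forall n \near U, E <= `|x k + y n|) ->
    \forall n \near U, `|x k + y n| < E.
  move=> nk; have [//|] := in_ultra_setVsetC [set n | E <= `|x k + y n|] UU.
  by apply: filterS => n /= /negP; rewrite -ltNge.
have [k /lt_near kE] := filter_ex K.
(* The bound is contradictory: [3 * E] is this norm minus [3 * e]. *)
suff : `|ultraclass UU (x + y)| <= 3 * E by rewrite /E; lra.
apply: ultranorm_le; apply: (filterS2 _ _ K kE) => n /lt_near nE knE.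
have [j [xkj xnj]] := filter_ex (filterI kE nE).
have -> : (x + y) n = (x n + y j) - (x k + y j) + (x k + y n).
  by rewrite /= [x k + y j]addrC addrKA addrA subrK.
have := ler_normD (x n + y j - (x k + y j)) (x k + y n).
have := ler_normB (x n + y j) (x k + y j).
by move: knE xkj xnj => /=; lra.
Qed.

Lemma near_iterated_le (x y : linfty X) (e : R) : 0 < e ->
  \forall k \near U, \forall n \near U,
    `|x k + y n| <= `|ultraclass UU x| + `|ultraclass UU y| + e.
Proof.
move=> e0; have e20 : 0 < e / 2 by lra.
apply: filterS (near_ultranorm_le x e20) => k xk.
apply: filterS (near_ultranorm_le y e20) => n yn.
by have := ler_normD (x k) (y n); lra.
Qed.

End ultrapower_iterated.

(** * Logarithmic levels and interpolation weights *)

Section weight.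
Context {R : realType}.

(* The factor 12 makes half a level multiply the norm by at least 7, which beats
   the loss of a factor 3 in [near_iterated_ge]. *)
Definition level (A : R) : R := ln (1 + A) / 12.

(* Constant on the upper half of each level, so that two points whose levels
   differ by at most 1/2 are always interpolated between the same two indices. *)
Definition weight (i : nat) (A : R) : R :=
  Num.max 0 (Num.min 1 (2 * (level A - i%:R))).

Lemma level_ge0 A : 0 <= A -> 0 <= level A.
Proof. by move=> A0; rewrite divr_ge0// ln_ge0// lerDl. Qed.

(** From [ln (1 + t) <= t] at [t = (B - A) / (1 + A)]. The extra factor [A] is the norm of the
    vector that a difference of weights multiplies. *)
Lemma level_lip A B : 0 <= A -> A <= B ->
  0 <= level B - level A /\ (level B - level A) * A <= (B - A) / 12.
Proof.
move=> A0 AB; have A1 : 0 < 1 + A by lra.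
have B1 : 0 < 1 + B by lra.
have lnAB : ln (1 + B) - ln (1 + A) = ln (1 + (B - A) / (1 + A)).
  rewrite -ln_div ?posrE//; congr ln.
  have -> : 1 + B = (1 + A) + (B - A) by lra.
  by rewrite mulrDl divff// gt_eqF.
have q0 : 0 <= (B - A) / (1 + A) by rewrite divr_ge0//; lra.
have qE : (B - A) / (1 + A) * (1 + A) = B - A by rewrite divfK// gt_eqF.
have l0 : 0 <= ln (1 + (B - A) / (1 + A)) by rewrite ln_ge0// lerDl.
have l1 : ln (1 + (B - A) / (1 + A)) <= (B - A) / (1 + A).
  by apply: le_ln1Dx; lra.
have -> : level B - level A = ln (1 + (B - A) / (1 + A)) / 12.
  by rewrite /level -mulrBl lnAB.
split; first by rewrite divr_ge0.
by have := ler_wpM2r A0 l1; nra.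
Qed.

(** Half a level is 6 in the logarithm, and [expR 6 >= 1 + 6]. *)
Lemma level_gap A B : 0 <= A -> 0 <= B -> level A + 1 / 2 <= level B ->
  7 * A <= B.
Proof.
move=> A0 B0; rewrite /level => AB.
have : ln (1 + A) + 6 <= ln (1 + B) by lra.
rewrite -ler_expR expRD !lnK ?posrE; [|lra|lra].
have := @expR_ge1Dx R 6 => e6.
have := ler_wpM2l (_ : 0 <= 1 + A) e6; nra.
Qed.

Lemma weight01 i A : 0 <= weight i A <= 1.
Proof.
rewrite /weight le_max lexx /=.
by rewrite ge_max ler01 ge_min lexx.
Qed.

Lemma weight_lip i A B : 0 <= A -> A <= B ->
  `|weight i B - weight i A| * A <= B - A.
Proof.
move=> A0 AB; have [l0 l1] := level_lip A0 AB.
have : `|weight i B - weight i A| <= 2 * (level B - level A).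
  rewrite /weight; set a := level A in l0 *; set b := level B in l0 *.
  rewrite /Num.max /Num.min; repeat case: ifPn; rewrite -?leNgt ler_norml; lra.
move=> /(ler_wpM2r A0); lra.
Qed.

Lemma weight_eq0 i A : level A <= i%:R -> weight i A = 0.
Proof. by move=> h; rewrite /weight; apply/max_idPl; rewrite ge_min; lra. Qed.

Lemma weight_eq1 i A : i%:R + 1 / 2 <= level A -> weight i A = 1.
Proof.
move=> h; rewrite /weight; have -> : Num.min 1 (2 * (level A - i%:R)) = 1.
  by apply/min_idPl; lra.
by apply/max_idPr.
Qed.

(** The difference is split so that the change of weight multiplies the vector of smaller norm; each
    of the two terms is then at most the distance. *)
Lemma norm_weighted_sub (V : normedModType R) (w : R -> R) (a b : V) :
  (forall A, 0 <= w A <= 1) ->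
  (forall A B, 0 <= A -> A <= B -> `|w B - w A| * A <= B - A) ->
  `|w `|a| *: a - w `|b| *: b| <= 2 * `|a - b|.
Proof.
move=> w01 wlip; wlog ab : a b / `|a| <= `|b|.
  move=> h; have [/h//|/ltW/h] := leP `|a| `|b|.
  by rewrite distrC [`|b - a|]distrC.
have -> : w `|a| *: a - w `|b| *: b =
    w `|b| *: (a - b) - (w `|b| - w `|a|) *: a.
  by rewrite scalerBr scalerBl opprB [RHS]addrC addrA subrK.
apply: le_trans (ler_normB _ _) _; rewrite !normrZ.
have := wlip _ _ (normr_ge0 a) ab.
have := lerB_dist b a; rewrite [`|b - a|]distrC.
have /andP[w0 w1] := w01 `|b|; rewrite (ger0_norm w0).
have := ler_wpM2r (normr_ge0 (a - b)) w1; lra.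
Qed.

End weight.

(** * Choice of the indices and the embedding *)

Section embedding.
Context {R : realType} (X : normedModType R) (U : set_system nat).
Variable UU : UltraFilter U.
Variables (N : set (ultrapower X UU)) (delta : R).
Hypothesis delta_gt0 : 0 < delta.
Hypothesis N_sep : forall a b, N a -> N b -> a <> b -> delta <= `|a - b|.
Hypothesis N_fin : forall r, finite_set [set a | N a /\ `|a| <= r].

(** Small enough that two errors [e] cost at most a twelfth of any distance in [N]. *)
Let e : R := delta / 24.

Let e_gt0 : 0 < e. Proof. by rewrite /e divr_gt0. Qed.

Definition head (i : nat) (a : ultrapower X UU) : linfty X :=
  (1 - weight i `|a|) *: repr a.

Definition tail (i : nat) (a : ultrapower X UU) : linfty X :=
  weight i `|a| *: repr a.

Definition blend (i k n : nat) (a : ultrapower X UU) : X :=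
  head i a k + tail i a n.

Lemma ultraclass_head i a :
  ultraclass UU (head i a) = (1 - weight i `|a|) *: a.
Proof. by rewrite ultraclassZ ultraclass_repr. Qed.

Lemma ultraclass_tail i a : ultraclass UU (tail i a) = weight i `|a| *: a.
Proof. by rewrite ultraclassZ ultraclass_repr. Qed.

Lemma head_add_tail i a : ultraclass UU (head i a + tail i a) = a.
Proof.
by rewrite ultraclassD ultraclass_head ultraclass_tail -scalerDl subrK scale1r.
Qed.

(** The factor 4 adds two bounds 2 from [norm_weighted_sub], one for heads and one for tails. *)
Definition admissible (i k n : nat) : Prop :=
  (forall a, N a -> level `|a| <= i.+1%:R ->
    `|a| / 3 - e <= `|blend i k n a| <= `|a| + e) /\
  (forall a b, N a -> N b -> level `|a| <= i.+1%:R -> level `|b| <= i.+1%:R ->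
    `|a - b| / 3 - e <= `|blend i k n a - blend i k n b|
      <= 4 * `|a - b| + e).

Let F i : set (ultrapower X UU) := [set a | N a /\ level `|a| <= i.+1%:R].

Lemma finite_level i : finite_set (F i).
Proof.
apply: sub_finite_set (N_fin (expR (i.+1%:R * 12))) => a [Na].
rewrite /level ler_pdivrMr// => la; split=> //.
have a1 : 0 < 1 + `|a| by rewrite ltr_pwDl.
by move: la; rewrite -ler_expR lnK ?posrE//; lra.
Qed.

(** The iterated-limit bounds apply to [head] and [tail] of a point and to their differences for a
    pair; finiteness of [F i] moves the quantifiers over points inside both [near]. *)
Lemma near_admissible i :
  \forall k \near U, \forall n \near U, admissible i k n.
Proof.
have single : \forall k \near U, forall a, F i a -> \forall n \near U,
    `|a| / 3 - e <= `|blend i k n a| <= `|a| + e.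
  apply: filter_finite_forall (finite_level i) _ => a _.
  have := near_iterated_le UU (head i a) (tail i a) e_gt0.
  have := near_iterated_ge UU (head i a) (tail i a) e_gt0.
  apply: filterS2 => k; apply: filterS2 => n.
  rewrite head_add_tail ultraclass_head ultraclass_tail !normrZ.
  have /andP[w0 w1] := weight01 i `|a|.
  rewrite !ger0_norm ?subr_ge0// -mulrDl subrK mul1r => l u.
  by apply/andP.
have pair : \forall k \near U, forall a, F i a -> forall b, F i b ->
    \forall n \near U, `|a - b| / 3 - e <= `|blend i k n a - blend i k n b|
      <= 4 * `|a - b| + e.
  apply: filter_finite_forall (finite_level i) _ => a _.
  apply: filter_finite_forall (finite_level i) _ => b _.
  pose x := head i a - head i b; pose y := tail i a - tail i b.
  have := near_iterated_le UU x y e_gt0; have := near_iterated_ge UU x y e_gt0.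
  apply: filterS2 => k; apply: filterS2 => n.
  have -> : ultraclass UU (x + y) = a - b.
    rewrite /x /y addrACA -opprD ultraclassD ultraclassN.
    by rewrite !head_add_tail.
  have -> : x k + y n = blend i k n a - blend i k n b.
    by rewrite /blend opprD addrACA.
  have ux : `|ultraclass UU x| <= 2 * `|a - b|.
    rewrite /x ultraclassD ultraclassN !ultraclass_head.
    apply: (@norm_weighted_sub _ _ (fun A => 1 - weight i A)) => [A|A B A0 AB].
      by have := weight01 i A; lra.
    rewrite opprB addrC addrA subrK distrC.
    exact: weight_lip.
  have uy : `|ultraclass UU y| <= 2 * `|a - b|.
    rewrite /y ultraclassD ultraclassN !ultraclass_tail.
    apply: norm_weighted_sub => [A|A B]; [exact: weight01|exact: weight_lip].
  by move=> l u; apply/andP; split=> //; lra.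
apply: filterS2 single pair => k sk pk.
have sn : \forall n \near U, forall a, F i a ->
    `|a| / 3 - e <= `|blend i k n a| <= `|a| + e.
  exact: filter_finite_forall (finite_level i) sk.
have pn : \forall n \near U, forall a, F i a -> forall b, F i b ->
    `|a - b| / 3 - e <= `|blend i k n a - blend i k n b| <= 4 * `|a - b| + e.
  apply: filter_finite_forall (finite_level i) _ => a Fa.
  by apply: filter_finite_forall (finite_level i) _ => b; exact: pk.
apply: filterS2 sn pn => n sn pn; split=> [a Na la|a b Na Nb la lb].
  exact: sn.
exact: pn.
Qed.

Lemma exists_admissible :
  exists k : nat -> nat, forall i, admissible i (k i) (k i.+1).
Proof.
pose S i := [set k | \forall n \near U, admissible i k n].
have US i : U (S i) by exact: near_admissible.
apply: (@chain_choice admissible S); first exact: filter_ex (US 0%N).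
(* The new index must both fit [k] and be generic for the next stage; both sets are in [U]. *)
move=> i k Sk; have [n [Sn Qn]] := filter_ex (filterI (US i.+1) Sk).
by exists n.
Qed.

Lemma exists_bilipschitz : exists f : ultrapower X UU -> X,
  forall a b, N a -> N b ->
    12^-1 * `|a - b| <= `|f a - f b| <= 5 * `|a - b|.
Proof.
have [k kP] := exists_admissible.
pose T i := blend i (k i) (k i.+1).
pose f (a : ultrapower X UU) := T (Num.truncn (level `|a|)) a.
have level_itv (a : ultrapower X UU) :
    (Num.truncn (level `|a|))%:R <= level `|a| <
      (Num.truncn (level `|a|)).+1%:R.
  by apply: truncn_itv; rewrite level_ge0.
(* [T i] remains valid half a level below [i]: there [T i] and its predecessor both take the
   representative at index [k i], with weights 0 and 1. The case [i < j] is the endpoint of level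
   exactly [i.+1]. *)
have fE i a : i%:R - 1 / 2 <= level `|a| <= i.+1%:R -> f a = T i a.
  rewrite /f; move: (level_itv a); set j := Num.truncn _.
  move=> /andP[j1 j2] /andP[i1 i2].
  have : (j < i.+2)%N by rewrite -(ltr_nat R) -[i.+2]addn1 natrD; lra.
  have : (i < j.+2)%N by rewrite -(ltr_nat R) -[j.+2]addn1 natrD; lra.
  rewrite !ltnS => ij ji.
  have [->//|] := eqVneq i j; rewrite neq_ltn => /orP[lij|lji].
    have jE : j = i.+1 by apply/eqP; rewrite eqn_leq ji lij.
    have w0 : weight j `|a| = 0 by apply: weight_eq0; rewrite jE.
    have w1 : weight i `|a| = 1 by apply: weight_eq1; move: j1;
      rewrite jE -natr1; lra.
    rewrite /T /blend /head /tail w0 w1 jE.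
    by rewrite subrr subr0 !scale1r !scale0r addr0 add0r.
  have iE : i = j.+1 by apply/eqP; rewrite eqn_leq ij lji.
  have w0 : weight i `|a| = 0 by apply: weight_eq0; rewrite iE; lra.
  have w1 : weight j `|a| = 1 by apply: weight_eq1; move: i1;
    rewrite iE -natr1; lra.
  rewrite /T /blend /head /tail w0 w1 iE.
  by rewrite subrr subr0 !scale1r !scale0r addr0 add0r.
have fN a : N a -> `|a| / 3 - e <= `|f a| <= `|a| + e.
  by move=> Na; apply: (kP _).1 => //; have /andP[_ /ltW] := level_itv a.
exists f => a b Na Nb.
have [->|/eqP ab] := eqVneq a b; first by rewrite !subrr !normr0 !mulr0 lexx.
have de : 24 * e <= `|a - b| by rewrite /e mulrC divfK// N_sep.
wlog lab : a b Na Nb ab de / level `|a| <= level `|b|.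
  move=> h; have [/h|/ltW lba] := leP (level `|a|) (level `|b|); first exact.
  rewrite (distrC a) (distrC (f a)); apply: h => //; last by rewrite distrC.
  by move=> ba; apply: ab.
have [close|far] := leP (level `|b|) (level `|a| + 1 / 2).
  (* A common index exists: the integer part for [a], or its successor if [b] has passed the next
     integer, since [a] is then in the upper half of its level. *)
  suff [i [ia ib]] : exists i : nat, i%:R - 1 / 2 <= level `|a| <= i.+1%:R /\
      i%:R - 1 / 2 <= level `|b| <= i.+1%:R.
    rewrite (fE _ _ ia) (fE _ _ ib).
    have /andP[_ ia1] := ia; have /andP[_ ib1] := ib.
    have := (kP i).2 a b Na Nb ia1 ib1; rewrite -/(T i a) -/(T i b).
    by move: e_gt0; lra.
  have := level_itv a; set i := Num.truncn _ => ia.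
  have [ib|ib] := leP (level `|b|) i.+1%:R; first by exists i; split; lra.
  by exists i.+1; split; rewrite -[i.+2%:R]natr1; lra.
(* Let [A], [B] be the norms and [D] the distance. Since [7 * A <= B], [D <= 8 * B / 7] and
   [B / 3 - A >= 4 * B / 21 >= D / 6]; the two errors leave [D / 12], whence the lower constant. *)
have /level_gap gap : level `|a| + 1 / 2 <= level `|b| by exact: ltW.
have := gap (normr_ge0 _) (normr_ge0 _).
have := fN a Na; have := fN b Nb.
have := ler_normB a b; have := ler_normB (f a) (f b).
have := lerB_dist b a; have := lerB_dist (f b) (f a).
rewrite [`|b - a|]distrC [`|f b - f a|]distrC.
by move: e_gt0 (normr_ge0 a); lra.
Qed.

End embedding.

Theorem mainTheorem3 (R : realType) (X : completeNormedModType R)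
    (U : set_system nat) (UU : UltraFilter U) (Unp : nonprincipal U)
    (N : set (normed_metric (ultrapower X UU))) (N_lf : locally_finite (set_type N)) :
  exists f : set_type N -> normed_metric X, bilipschitz_embedding f.
Proof.
have [[delta delta0 sep] fin] := N_lf.
have [f fP] : exists f : ultrapower X UU -> X, forall a b, N a -> N b ->
    12^-1 * `|a - b| <= `|f a - f b| <= 5 * `|a - b|.
  apply: (@exists_bilipschitz _ _ _ UU N delta) => [//|a b Na Nb ab|r].
    have := sep (SigSub (mem_set Na)) (SigSub (mem_set Nb)).
    apply; by move=> /(congr1 set_val).
  (* Local finiteness concerns balls centred in [N], so the ball about the origin is enclosed in one
     about some [a0] in [N], with a radius positive for every [r]. *)
  have [->|/set0P[a0 Na0]] := eqVneq N set0.
    by apply: sub_finite_set (finite_set0 _) => a [].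
  pose c : set_type N := SigSub (mem_set Na0).
  have r0 : 0 < `|r| + `|(a0 : ultrapower X UU)| + 1.
    by rewrite ltr_wpDl// addr_ge0.
  apply: sub_finite_set (finite_image set_val (fin c _ r0)) => a [Na ar].
  exists (SigSub (mem_set Na)) => //.
  have : `|(a0 : ultrapower X UU) - a| <= `|r| + `|(a0 : ultrapower X UU)| + 1.
    by have := ler_normB (a0 : ultrapower X UU) a; have := ler_norm r; lra.
  exact.
exists (fun a => f (set_val a)); exists 60, 12^-1.
split; first by rewrite invr_gt0.
move=> a b; have := fP _ _ (set_valP a) (set_valP b).
have -> : 12^-1 * 60 = 5 :> R by lra.
by move=> /andP.
Qed.
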